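(* Fix integers $r>0$ and $a,b$ with $\gcd(a,b)=1$ and $ab<0$. Then there is $N$ such that for $n\ge N$ the cardinality $\#B^r_{a,b;n}$ agrees with a quasipolynomial in $n$ of period $|ab|$, i.e. there are polynomials $p_1,\dots,p_{|ab|}$ with $\#B^r_{a,b;n}=p_l(n)$ whenever $n\ge N$ and $n\equiv l\pmod{|ab|}$.
   Context: Partitions are identified with Young diagrams: finite sets $\lambda\subset\mathbb{Z}_{\ge0}^2$ such that $(i,j)\in\lambda$ implies $(i',j')\in\lambda$ for $0\le i'\le i$, $0\le j'\le j$. Box $(i,j)$ has color $ai+bj\bmod n$. $\lambda$ is $(a,b;n)$-balanced if each residue class mod $n$ is the color of exactly $r$ boxes of $\lambda$; $B^r_{a,b;n}$ is the set of $(a,b;n)$-balanced partitions of $rn$. *)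

(* Defs.v *)
From mathcomp Require Import all_boot all_order all_algebra.
Set Implicit Arguments. Unset Strict Implicit. Unset Printing Implicit Defensive.
Import Order.TTheory GRing.Theory Num.Theory.
Local Open Scope ring_scope.

(* Young diagrams with all boxes inside the square [0,m) x [0,m):
   finite sets of boxes (i,j) closed under going down/left.  Every Young
   diagram with m boxes lies inside this square, so for partitions of m
   this is no restriction. *)
Definition young (m : nat) (L : {set 'I_m * 'I_m}) : bool :=
  [forall x in L, forall y : 'I_m * 'I_m,
     ((nat_of_ord y.1 <= x.1) && (nat_of_ord y.2 <= x.2))%N ==> (y \in L)].

Definition color (a b : int) (n i j : nat) : int :=
  ((a * (i%:Z) + b * (j%:Z)) %% (n%:Z))%Z.

Definition balanced (a b : int) (n r m : nat) (L : {set 'I_m * 'I_m}) : bool :=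
  [forall c : 'I_n,
     #|[set x in L | color a b n x.1 x.2 == (nat_of_ord c)%:Z]| == r].

Definition Bset (a b : int) (r n : nat) : {set {set 'I_(r * n) * 'I_(r * n)}} :=
  [set L | [&& young L, #|L| == (r * n)%N & balanced a b n r L]].

Definition Bcard (a b : int) (r n : nat) : nat := #|Bset a b r n|.

(* Main.v *)
(** A Young diagram is determined by the numbers m(C) of its boxes on the lines
    a i - B j = C (where b = -B): since the step (B, a) has positive
    coordinates, the boxes on such a line form an initial segment of it.  In
    terms of m, being a diagram means m(C) <= m(C - a) and m(C) <= m(C + B), up
    to an error of 1 on a residue class of nonpositive, respectively
    nonnegative, levels C, and being balanced means that
    \sum_t m(c + t n) = r for all c.  Cut the levels into strands of length n,
    and these into blocks of p = a B consecutive levels; reading all strands in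
    parallel, m becomes a path in a finite graph whose vertices are blocks with
    values in [0, r].  Along a path m decreases on the strands of positive level
    and increases on those of negative level, so the only cycles of the graph
    are loops and the number of paths of length k is eventually a polynomial
    in k.  The gluing condition between the end of each strand and the start of
    the next one only depends on n mod p. *)

Require Import Defs.
From mathcomp Require Import all_boot all_order all_algebra.
From mathcomp Require Import zify ring.
Import Order.TTheory GRing.Theory Num.Theory.
Local Open Scope ring_scope.

(** * Counting paths *)

Definition eventually_poly (f : nat -> nat) : Prop :=
  exists N : nat, exists q : {poly rat},
    forall k : nat, (N <= k)%N -> (f k)%:R = q.[k%:R].

Lemma eventually_poly_add (f g : nat -> nat) :
  eventually_poly f -> eventually_poly g ->
  eventually_poly (fun k => (f k + g k)%N).
Proof.
move=> [N [q fq]] [N' [q' gq]]; exists (N + N')%N, (q + q') => k le_k.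
by rewrite natrD fq ?gq ?hornerD //; lia.
Qed.

Lemma eventually_poly_sum (I : finType) (P : pred I) (f : I -> nat -> nat) :
  (forall i, P i -> eventually_poly (f i)) ->
  eventually_poly (fun k => \sum_(i | P i) f i k)%N.
Proof.
move=> fP.
suff: forall s : seq I, eventually_poly (fun k => \sum_(i <- s | P i) f i k)%N.
  by move=> /(_ (index_enum I)).
elim=> [|i s [N [q IHs]]].
  by exists 0%N, 0 => k _; rewrite big_nil horner0.
case Pi: (P i); last by exists N, q => k ?; rewrite big_cons Pi IHs.
have [N' [q' f'q]] := eventually_poly_add _ _ (fP i Pi) (ex_intro _ N (ex_intro _ q IHs)).
by exists N', q' => k le_k; rewrite big_cons Pi f'q.
Qed.

(** Induction on the size: the difference of ['X^(d.+1)] has degree d and leading coefficient d + 1,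
    so subtracting a multiple of it removes the coefficient of degree d from [q]. *)
Lemma poly_antidifference (q : {poly rat}) :
  exists Q : {poly rat}, forall x, Q.[x + 1] - Q.[x] = q.[x].
Proof.
elim: (size q) {-2}q (leqnn (size q)) => {q} [|d IHd] q.
  by rewrite leqn0 size_poly_eq0 => /eqP->; exists 0 => x; rewrite !horner0 subr0.
move=> le_q.
pose c := q`_d / d.+1%:R.
pose D : {poly rat} := \poly_(i < d.+1) 'C(d.+1, i)%:R.
have DE x : D.[x] = (x + 1) ^+ d.+1 - x ^+ d.+1.
  rewrite horner_poly exprD1n [in RHS]big_ord_recr /= binn mulr1n addrK.
  by apply: eq_bigr => i _; rewrite mulr_natl.
have le_D : (size (q - c *: D)%R <= d)%N.
  apply/leq_sizeP => j; rewrite leq_eqVlt coefB coefZ coef_poly.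
  case/orP => [/eqP<-|lt_dj]; first by rewrite ltnSn binSn divfK ?subrr // pnatr_eq0.
  by rewrite ltnNge lt_dj mulr0 subr0 nth_default // (leq_trans le_q).
have [Q QE] := IHd _ le_D; exists (Q + c *: 'X^(d.+1)) => x.
have := QE x; rewrite !(hornerD, hornerN, hornerZ, hornerXn) DE => E.
rewrite opprD addrACA E mulrBr; ring.
Qed.

Lemma eventually_poly_antidifference (f g : nat -> nat) :
  eventually_poly g -> (forall k, f k.+1 = (f k + g k)%N) -> eventually_poly f.
Proof.
move=> [N [q gq]] fS; have [Q QE] := poly_antidifference q.
(* The constant is chosen so that the polynomial takes the value [f N] at N. *)
exists N, (Q + ((f N)%:R - Q.[N%:R])%:P) => k /subnK<-.
elim: (k - N)%N => [|i IHi]; first by rewrite add0n hornerD hornerC addrC subrK.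
have E := QE (i + N)%:R; have G := gq _ (leq_addl i N).
rewrite addSn fS [LHS]natrD G IHi -E -[(i + N).+1]addn1 [in RHS]natrD !hornerD !hornerC.
by ring.
Qed.

Lemma eventually_poly_shift (f g : nat -> nat) :
  eventually_poly g -> (forall k, f k.+1 = g k) -> eventually_poly f.
Proof.
move=> [N [q gq]] fS; exists N.+1, (q \Po ('X - 1%:P)) => -[//|k] le_k.
by rewrite fS gq // horner_comp !hornerE /= -addn1 natrD addrK.
Qed.

Definition paths (S : finType) (R : rel S) (Q : pred S) (k : nat) (x : S) : nat :=
  #|[set s : k.-tuple S | path R x s && Q (last x s)]|.

Lemma pathsS (S : finType) (R : rel S) (Q : pred S) (k : nat) (x : S) :
  paths S R Q k.+1 x = (\sum_(y | R x y) paths S R Q k y)%N.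
Proof.
rewrite /paths -sum1dep_card.
rewrite (reindex (fun yt : S * k.-tuple S => [tuple of yt.1 :: yt.2])) /=; last first.
  exists (fun s => (thead s, [tuple of behead s])) => [[y t] _|s _].
    by congr (_, _); apply: val_inj.
  by case/tupleP: s => y t; apply: val_inj.
under eq_bigl => yt do rewrite -andbA.
rewrite -(pair_big_dep (fun y => R x y)
  (fun y (t : k.-tuple S) => path R y t && Q (last y t)) (fun _ _ => 1%N)) /=.
by apply: eq_bigr => y _; rewrite sum1dep_card.
Qed.

(* Splitting off the first step leaves a stationary term and terms of smaller
   rank, so by induction on the rank one has to sum a polynomial. *)
Lemma paths_eventually_poly (S : finType) (R : rel S) (rk : S -> nat)
    (Q : pred S) (x : S) :
  (forall x y, R x y -> x = y \/ (rk y < rk x)%N) ->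
  eventually_poly (fun k => paths S R Q k x).
Proof.
move=> Rrk; elim: (rk x).+1 {-2}x (ltnSn (rk x)) => {x} // d IHd x lt_x.
pose g k := (\sum_(y | R x y && (y != x)) paths S R Q k y)%N.
have g_poly : eventually_poly g.
  apply: eventually_poly_sum => y /andP[/Rrk[->|lt_yx]]; first by rewrite eqxx.
  by move=> _; apply: IHd; lia.
case Rxx: (R x x).
  apply: eventually_poly_antidifference g_poly _ => k.
  by rewrite pathsS (bigD1 x).
apply: eventually_poly_shift g_poly _ => k.
rewrite pathsS; apply: eq_bigl => y; case: eqP => [->|]; rewrite ?Rxx ?andbT //.
Qed.

(** * Profiles as paths of blocks *)

Section Profiles.
Local Open Scope nat_scope.
Variables a B T K r : nat.

(* Levels are shifted by T n, to be natural numbers: C stands for the line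
   a i - B j = C - T n.  The slacks mark the levels of the boxes on the two
   axes, which have no left, respectively no bottom, neighbour. *)
Definition left_slack (n C : nat) : bool := (C <= T * n) && (C == T * n %[mod B]).
Definition bottom_slack (n C : nat) : bool := (T * n <= C) && (C == T * n %[mod a]).

(** The line counts of a balanced diagram, described without boxes. The first clause says nothing
    about levels below [a]; there the last clause makes the function vanish. *)
Definition profile (n : nat) (m : nat -> nat) : Prop :=
  [/\ forall C, m (C + a) <= m C + left_slack n (C + a),
      forall C, m C <= m (C + B) + bottom_slack n C,
      forall c, c < n -> \sum_(t < K) m (t * n + c) = r
    & forall C, (C < a) || (K * n <= C) -> m C = 0].

Lemma eq_profile n m m' : m =1 m' -> profile n m -> profile n m'.
Proof.
move=> E [mA mB mS m0]; split=> [C|C|c lt_c|C C0]; rewrite -?E ?mA ?mB ?m0 //.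
by rewrite -(mS c lt_c); apply: eq_bigr => t _; rewrite E.
Qed.

(** As x covers at most two strands, t alone decides on which side of the origin level [T * n] the
    position lies, unless t + 1 = T. Excluding x = 0 settles the case t = T. *)
Lemma add_strand_leq (t n x : nat) : 0 < x <= 2 * n ->
  (t * n + x <= T * n) = (t.+1 < T) || (t.+1 == T) && (x <= n).
Proof.
move=> /andP[x_gt0 le_x]; case: (leqP T t) => [le_Tt|].
  have lt_n : T * n < t * n + x.
    by rewrite -[ltnLHS]addn0 -addnS leq_add // leq_mul.
  by rewrite leqNgt lt_n gtn_eqF // ltnNge leqW.
move=> /subnK<-; case: (T - t.+1) => [|d].
  by rewrite add0n mulSn addnC leq_add2r ltnn eqxx.
rewrite addSn mulSn mulnDl mulSn !addnA [t * n + x]addnC leq_add2r.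
by rewrite ltnS leq_addl (leq_trans le_x) // mulSn mul1n addnAC leq_addr.
Qed.

Lemma strand_leq_add (t n x : nat) : x < 2 * n ->
  (T * n <= t * n + x) = (T <= t) || (t.+1 == T) && (n <= x).
Proof.
move=> lt_x; case: (leqP T t) => [le_Tt|].
  by rewrite (leq_trans (leq_mul le_Tt (leqnn n))) ?leq_addr.
move=> /subnK<-; case: (T - t.+1) => [|d].
  by rewrite add0n mulSn addnC leq_add2l eqxx.
rewrite addSn mulSn mulnDl mulSn !addnA [t * n + x]addnC leq_add2r.
rewrite ltn_eqF ?ltnS ?leq_addl //=; apply/negbTE; rewrite -ltnNge.
by rewrite (leq_trans lt_x) // mulSn mul1n addnAC leq_addr.
Qed.

(** This transports slack between the actual size and the reference size: [add_strand_leq] decides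
    the side of the origin, and the congruence only sees residues modulo B. *)
Lemma left_slack_shift (n n0 t x x0 : nat) :
  n = n0 %[mod B] -> x = x0 %[mod B] -> 0 < x <= 2 * n -> 0 < x0 <= 2 * n0 ->
  (x <= n) = (x0 <= n0) -> left_slack n (t * n + x) = left_slack n0 (t * n0 + x0).
Proof.
move=> nB xB x_bd x0_bd xn; rewrite /left_slack !add_strand_leq // xn.
have sm y : y * n = y * n0 %[mod B] by rewrite -modnMmr nB modnMmr.
by rewrite sm -modnDm sm xB modnDm.
Qed.

Lemma bottom_slack_shift (n n0 t x x0 : nat) :
  n = n0 %[mod a] -> x = x0 %[mod a] -> x < 2 * n -> x0 < 2 * n0 ->
  (n <= x) = (n0 <= x0) -> bottom_slack n (t * n + x) = bottom_slack n0 (t * n0 + x0).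
Proof.
move=> na xa x_lt x0_lt xn; rewrite /bottom_slack !strand_leq_add // xn.
have sm y : y * n = y * n0 %[mod a] by rewrite -modnMmr na modnMmr.
by rewrite sm -modnDm sm xa modnDm.
Qed.

(* The values of a profile at q consecutive positions of each of the K strands
   [t n, (t + 1) n). *)
Local Notation state q := {ffun 'I_K * 'I_q -> 'I_r.+1}.

(** The default 0 matters: [glue_window] reads the strand after the last one, where a profile
    vanishes. *)
Definition entry (q : nat) (X : state q) (t v : nat) : nat :=
  if (insub t, insub v) is (Some t', Some v') then X (t', v') else 0.

Lemma entry_ord q (X : state q) (t : 'I_K) (v : 'I_q) : entry q X t v = X (t, v).
Proof. by rewrite /entry !valK. Qed.

Lemma entry_out q (X : state q) t v : K <= t -> entry q X t v = 0.
Proof. by move=> le_Kt; rewrite /entry insubN // -leqNgt. Qed.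

Lemma entry_inj q (X Y : state q) :
  (forall t v, t < K -> v < q -> entry q X t v = entry q Y t v) -> X = Y.
Proof.
by move=> XY; apply/ffunP => -[t v]; apply: ord_inj; rewrite -!entry_ord XY.
Qed.

Definition block_of (q : nat) (f : nat -> nat -> nat) : state q :=
  [ffun tv : 'I_K * 'I_q => inord (f tv.1 tv.2)].

Lemma entry_block_of q f t v : t < K -> v < q -> f t v <= r -> entry q (block_of q f) t v = f t v.
Proof.
move=> lt_t lt_v le_f; have := entry_ord q (block_of q f) (Ordinal lt_t) (Ordinal lt_v).
by rewrite ffunE inordK //= => ->.
Qed.

Hypotheses (a_gt0 : 0 < a) (B_gt0 : 0 < B).
Let p := a * B.
Variable l : nat.
Hypothesis lt_lp : l < p.
(** Two blocks and the tail are enough: a window of 2 p levels fits in one strand, and a gluing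
    window placed at offset p meets the end of the strand at the same point as in a longer
    strand. *)
Let n0 := l + 2 * p.

(* The constraints are tested at the reference size n0; this is legitimate
   since left_slack and bottom_slack only depend on the size modulo p away from the origin. *)
Definition locally_ok (N : nat) (h : nat -> nat -> nat) (o : nat -> nat) : bool :=
  [forall t : 'I_K, forall w : 'I_N,
     ((w + a < N) ==> (h t (w + a) <= h t w + left_slack n0 (o t + (w + a)))) &&
     ((w + B < N) ==> (h t w <= h t (w + B) + bottom_slack n0 (o t + w)))].

Definition sum_ok (q : nat) (X : state q) : bool :=
  [forall v : 'I_q, \sum_(t < K) entry q X t v == r].

Definition pair_window (X Y : state p) (t v : nat) : nat :=
  if v < p then entry p X t v else entry p Y t (v - p).

Definition glue_window (X Y : state p) (Z : state l) (t w : nat) : nat :=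
  if w < p then entry p Y t w else
  if w < p + l then entry l Z t (w - p) else entry p X t.+1 (w - (p + l)).

(** The strand sums are tested on the new block only; [gluing] tests those of the first block. *)
Definition block_step : rel (state p) := fun X Y =>
  locally_ok (2 * p) (pair_window X Y) (fun t => t * n0) && sum_ok p Y.

(* X and Y are the first and last blocks, and Z holds the n mod p levels
   remaining at the end of each strand; the last clause keeps a profile away
   from level 0, where C - a would be truncated. *)
Definition gluing (X Y : state p) (Z : state l) : bool :=
  [&& locally_ok (2 * p + l) (glue_window X Y Z) (fun t => t * n0 + p),
      sum_ok p X, sum_ok l Z & [forall v : 'I_p, (v < a) ==> (entry p X 0 v == 0)]].

Lemma locally_okP N h o :
  reflect ((forall t w, t < K -> w + a < N ->
              h t (w + a) <= h t w + left_slack n0 (o t + (w + a))) /\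
           (forall t w, t < K -> w + B < N ->
              h t w <= h t (w + B) + bottom_slack n0 (o t + w)))
          (locally_ok N h o).
Proof.
apply: (iffP 'forall_forallP) => [H|[HA HB] t w].
  split=> t w lt_t lt_w.
    have lt_wN : w < N by lia.
    by have /andP[/implyP/(_ lt_w)] := H (Ordinal lt_t) (Ordinal lt_wN).
  have lt_wN : w < N by lia.
  by have /andP[_ /implyP/(_ lt_w)] := H (Ordinal lt_t) (Ordinal lt_wN).
by apply/andP; split; apply/implyP => lt_w; [apply: HA | apply: HB].
Qed.

Lemma sum_okP q (X : state q) :
  reflect (forall v, v < q -> \sum_(t < K) entry q X t v = r) (sum_ok q X).
Proof.
apply: (iffP 'forall_eqP) => [H v lt_v|H v]; last exact: H.
exact: (H (Ordinal lt_v)).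
Qed.

Let p_gt0 : 0 < p. Proof. by rewrite muln_gt0 a_gt0. Qed.
Let le_ap : a <= p. Proof. by rewrite leq_pmulr. Qed.
Let le_Bp : B <= p. Proof. by rewrite leq_pmull. Qed.

Definition decode (k : nat) (X : state p) (s : seq (state p)) (Z : state l) (C : nat) : nat :=
  let n := p * k.+1 + l in
  let t := C %/ n in let c := C %% n in
  if c < p * k.+1 then entry p (nth X (X :: s) (c %/ p)) t (c %% p)
  else entry l Z t (c - p * k.+1).

(** * Functions on levels reassembled from their blocks *)

Section Decoding.
Variables (k : nat) (X : state p) (s : seq (state p)) (Z : state l).
Hypothesis size_s : size s = k.
Let n := p * k.+1 + l.
Local Notation m := (decode k X s Z).

Lemma decode_split t c : c < n ->
  m (t * n + c) = if c < p * k.+1 then entry p (nth X (X :: s) (c %/ p)) t (c %% p)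
                  else entry l Z t (c - p * k.+1).
Proof.
move=> lt_c; have n_gt0 : 0 < n by lia.
by rewrite /decode -/n divnMDl // modnMDl (divn_small lt_c) (modn_small lt_c) addn0.
Qed.

Lemma decode_block t u v : u < k.+1 -> v < p ->
  m (t * n + (p * u + v)) = entry p (nth X (X :: s) u) t v.
Proof.
move=> lt_u lt_v; have lt_c : p * u + v < p * k.+1.
  have : p * u.+1 <= p * k.+1 by rewrite leq_mul.
  by lia.
rewrite decode_split; last by rewrite /n; lia.
by rewrite lt_c (mulnC p) divnMDl // modnMDl (divn_small lt_v) (modn_small lt_v) addn0.
Qed.

Lemma decode_tail t w : w < l -> m (t * n + (p * k.+1 + w)) = entry l Z t w.
Proof.
move=> lt_w; rewrite decode_split; last by rewrite ltn_add2l.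
by rewrite ltnNge leq_addr addKn.
Qed.

Lemma decode_step t u v : u < k -> v < 2 * p ->
  m (t * n + (p * u + v)) = pair_window (nth X (X :: s) u) (nth X s u) t v.
Proof.
move=> lt_u lt_v; rewrite /pair_window; case: ltnP => le_v; first by rewrite decode_block //; lia.
have -> : p * u + v = p * u.+1 + (v - p) by lia.
by rewrite decode_block //; lia.
Qed.

Lemma decode_glue t w : w < 2 * p + l ->
  m (t * n + (p * k + w)) = glue_window X (last X s) Z t w.
Proof.
move=> lt_w; rewrite /glue_window; case: ltnP => le_w.
  by rewrite decode_block // -size_s (last_nth X).
case: ltnP => le_w'.
  have -> : p * k + w = p * k.+1 + (w - p) by lia.
  by rewrite decode_tail //; lia.
(* The last block and the tail end at p k + p + l = n, so this position belongs to the next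
   strand. *)
have -> : t * n + (p * k + w) = t.+1 * n + (p * 0 + (w - (p + l))).
  by rewrite mulSn /n; lia.
by rewrite decode_block //; lia.
Qed.

Lemma decode_out C : K * n <= C -> m C = 0.
Proof.
move=> le_C; have n_gt0 : 0 < n by rewrite /n; lia.
have le_t : K <= C %/ n by rewrite leq_divRL.
by rewrite /decode -/n; case: ifP => _; rewrite entry_out.
Qed.

Let modB_p x y : p * x + y = y %[mod B].
Proof. by rewrite /p mulnAC modnMDl. Qed.
Let moda_p x y : p * x + y = y %[mod a].
Proof. by rewrite /p -mulnA mulnC modnMDl. Qed.

Let nB : n = n0 %[mod B].
Proof. by rewrite /n /n0 addnC -[in RHS](mulnC p) [in RHS]addnC addnC !modB_p. Qed.
Let na : n = n0 %[mod a].
Proof. by rewrite /n /n0 addnC -[in RHS](mulnC p) [in RHS]addnC addnC !moda_p. Qed.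

Lemma left_slack_step t u v : u < k -> 0 < v < 2 * p ->
  left_slack n (t * n + (p * u + v)) = left_slack n0 (t * n0 + v).
Proof.
move=> lt_u /andP[v_gt0 lt_v].
have : p * u.+2 <= p * k.+1 by rewrite leq_mul.
by move=> ?; apply: left_slack_shift; first exact: nB; rewrite ?modB_p //; rewrite /n /n0; lia.
Qed.

Lemma bottom_slack_step t u v : u < k -> v < 2 * p ->
  bottom_slack n (t * n + (p * u + v)) = bottom_slack n0 (t * n0 + v).
Proof.
move=> lt_u lt_v.
have : p * u.+2 <= p * k.+1 by rewrite leq_mul.
by move=> ?; apply: bottom_slack_shift; first exact: na; rewrite ?moda_p //; rewrite /n /n0; lia.
Qed.

Lemma left_slack_glue t w : 0 < w < 2 * p + l ->
  left_slack n (t * n + (p * k + w)) = left_slack n0 (t * n0 + p + w).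
Proof.
move=> /andP[w_gt0 lt_w]; rewrite -(addnA (t * n0)).
apply: left_slack_shift; first exact: nB; try (rewrite /n /n0; lia).
by rewrite modB_p -[p in RHS]muln1 modB_p.
Qed.

Lemma bottom_slack_glue t w : w < 2 * p + l ->
  bottom_slack n (t * n + (p * k + w)) = bottom_slack n0 (t * n0 + p + w).
Proof.
move=> lt_w; rewrite -(addnA (t * n0)).
apply: bottom_slack_shift; first exact: na; try (rewrite /n /n0; lia).
by rewrite moda_p -[p in RHS]muln1 moda_p.
Qed.

(** An inequality based in one of the first k blocks of a strand is seen by the window of a step,
    any other by the gluing window; since a and B are at most p, its other end lies in the same
    window. *)
Lemma profile_decode :
  reflect (profile n m) (path block_step X s && gluing X (last X s) Z).
Proof.
have n_gt0 : 0 < n by rewrite /n; lia.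
apply: (iffP andP) => [[/(pathP X) pR] | [mA mB mS m0]].
  case/and4P => /locally_okP[gA gB] /sum_okP sX /sum_okP sZ /forall_inP X0.
  have {}pR u (lt_u : u < k) : block_step (nth X (X :: s) u) (nth X s u).
    by apply: pR; rewrite size_s.
  have split_C C : C < K * n -> exists2 t, t < K & exists2 c, c < n & C = t * n + c.
    move=> lt_C; exists (C %/ n); first by rewrite ltn_divLR.
    by exists (C %% n); rewrite ?ltn_mod // -divn_eq.
  have split_c c : c < n -> (exists2 u, u < k & exists2 v, v < p & c = p * u + v)
      \/ (exists2 w, w < p + l & c = p * k + w).
    move=> lt_c; case: (ltnP c (p * k)) => le_c.
      left; exists (c %/ p); first by rewrite ltn_divLR // mulnC.
      by exists (c %% p); rewrite ?ltn_mod // mulnC -divn_eq.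
    by right; exists (c - p * k); move: lt_c; rewrite /n; lia.
  split.
  - move=> C; case: (ltnP C (K * n)) => [/split_C|]; last first.
      by move=> le_C; rewrite decode_out // (leq_trans le_C) ?leq_addr.
    case=> t lt_t [c lt_c ->].
    case: (split_c c lt_c) => [[u lt_u [v lt_v ->]]|[w lt_w ->]].
      rewrite -!addnA left_slack_step ?decode_step //; try lia.
      by have /andP[/locally_okP[sA _] _] := pR u lt_u; apply: sA => //; lia.
    by rewrite -!addnA left_slack_glue ?decode_glue //; try lia; apply: gA => //; lia.
  - move=> C; case: (ltnP C (K * n)) => [/split_C|]; last by move=> /decode_out->.
    case=> t lt_t [c lt_c ->].
    case: (split_c c lt_c) => [[u lt_u [v lt_v ->]]|[w lt_w ->]].
      rewrite -!addnA bottom_slack_step ?decode_step //; try lia.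
      by have /andP[/locally_okP[_ sB] _] := pR u lt_u; apply: sB => //; lia.
    by rewrite -!addnA bottom_slack_glue ?decode_glue //; try lia; apply: gB => //; lia.
  - move=> c lt_c; case: (ltnP c (p * k.+1)) => le_c.
      have [u lt_u [v lt_v ->]] : exists2 u, u < k.+1 & exists2 v, v < p & c = p * u + v.
        exists (c %/ p); first by rewrite ltn_divLR // mulnC.
        by exists (c %% p); rewrite ?ltn_mod // mulnC -divn_eq.
      under eq_bigr => t _ do rewrite decode_block //.
      case: u lt_u => [|u] lt_u; first exact: sX.
      by have /andP[_ /sum_okP sS] := pR u lt_u; apply: sS.
    have lt_w : c - p * k.+1 < l by rewrite ltn_subLR.
    rewrite -(sZ _ lt_w); apply: eq_bigr => t _.
    by rewrite -[in LHS](subnKC le_c) decode_tail.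
  - move=> C /orP[lt_C|/decode_out//].
    have -> : C = 0 * n + (p * 0 + C) by lia.
    have lt_Cp : C < p by lia.
    by rewrite decode_block //=; apply/eqP; apply: (X0 (Ordinal lt_Cp)).
split.
  apply/(pathP X) => u; rewrite size_s => lt_u; apply/andP; split.
    apply/locally_okP; split=> t w lt_t lt_w.
by rewrite -!decode_step -?(left_slack_step _ u); try lia;
  have := mA (t * n + (p * u + w)); rewrite -!addnA.
    by rewrite -!decode_step -?(bottom_slack_step _ u) //; try lia;
      have := mB (t * n + (p * u + w)); rewrite -!addnA.
  apply/sum_okP => v lt_v; rewrite -[RHS](mS (p * u.+1 + v)); last first.
    have : p * u.+2 <= p * k.+1 by rewrite leq_mul.
    by rewrite /n; lia.
  by apply: eq_bigr => t _; rewrite decode_block.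
apply/and4P; split.
- apply/locally_okP; split=> t w lt_t lt_w.
    by rewrite -!decode_glue -?left_slack_glue //; try lia;
      have := mA (t * n + (p * k + w)); rewrite -!addnA.
  by rewrite -!decode_glue -?bottom_slack_glue //; try lia;
    have := mB (t * n + (p * k + w)); rewrite -!addnA.
- apply/sum_okP => v lt_v; rewrite -[RHS](mS (p * 0 + v)); last by rewrite /n; lia.
  by apply: eq_bigr => t _; rewrite decode_block.
- apply/sum_okP => v lt_v; rewrite -[RHS](mS (p * k.+1 + v)); last by rewrite /n; lia.
  by apply: eq_bigr => t _; rewrite decode_tail.
apply/forall_inP => v lt_v; apply/eqP; rewrite -(decode_block 0 0) // mul0n muln0.
by apply: m0; rewrite lt_v.
Qed.

End Decoding.

Lemma decode_inj k X s Z X' s' Z' :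
  size s = k -> size s' = k -> decode k X s Z =1 decode k X' s' Z' ->
  [/\ X = X', s = s' & Z = Z'].
Proof.
move=> sz sz' E.
have nthE u : u < k.+1 -> nth X (X :: s) u = nth X' (X' :: s') u.
  by move=> lt_u; apply: entry_inj => t v lt_t lt_v;
    rewrite -(@decode_block k X s Z) // -(@decode_block k X' s' Z') // E.
have XX : X = X' by apply: (nthE 0).
split=> //; last first.
  by apply: entry_inj => t v lt_t lt_v; rewrite -(@decode_tail k X s) // E decode_tail.
apply: (@eq_from_nth _ X) => [|u]; first by rewrite sz.
by rewrite sz => lt_u; have /= -> := nthE u.+1 lt_u; rewrite XX.
Qed.

Lemma decode_surj k m : profile (p * k.+1 + l) m ->
  exists X (s : k.-tuple (state p)) Z, decode k X s Z =1 m.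
Proof.
set n := p * k.+1 + l => -[_ _ mS m0].
have n_gt0 : 0 < n by rewrite /n; lia.
(* Each value is a summand of a strand sum equal to r, so it fits in ['I_r.+1]. *)
have m_le t c : t < K -> c < n -> m (t * n + c) <= r.
  by move=> lt_t /mS<-; rewrite (bigD1 (Ordinal lt_t)) //= leq_addr.
pose blk u : state p := block_of p (fun t v => m (t * n + (p * u + v))).
exists (blk 0), [tuple of mkseq (fun u => blk u.+1) k],
  (block_of l (fun t w => m (t * n + (p * k.+1 + w)))) => C.
case: (ltnP C (K * n)) => le_C; last by rewrite decode_out ?size_tuple // m0 ?le_C ?orbT.
have -> : C = C %/ n * n + C %% n by rewrite -divn_eq.
have lt_t : C %/ n < K by rewrite ltn_divLR.
have := ltn_pmod C n_gt0; move: (C %/ n) (C %% n) lt_t => t c lt_t lt_c.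
rewrite decode_split ?size_tuple //; case: ltnP => le_c; last first.
  by rewrite entry_block_of ?subnKC // ?m_le // ltn_subLR.
have lt_u : c %/ p < k.+1 by rewrite ltn_divLR // mulnC.
have cE : p * (c %/ p) + c %% p = c by rewrite mulnC -divn_eq.
have -> : nth (blk 0) (blk 0 :: mkseq (fun u => blk u.+1) k) (c %/ p) = blk (c %/ p).
  by case: (c %/ p) lt_u => [|u] lt_u //=; rewrite nth_mkseq.
by rewrite entry_block_of ?ltn_mod // cE // m_le.
Qed.

(* p is B steps of length a, none of which has left slack if T <= t, and also a
   steps of length B, none of which has bottom slack if t < T. *)
Lemma block_step_mono X Y t v : block_step X Y -> t < K -> v < p ->
  (T <= t -> entry p Y t v <= entry p X t v) /\ (t < T -> entry p X t v <= entry p Y t v).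
Proof.
case/andP => /locally_okP[hA hB] _ lt_t lt_v.
have -> : entry p Y t v = pair_window X Y t (v + p) by rewrite /pair_window ltnNge leq_addl addnK.
have -> : entry p X t v = pair_window X Y t v by rewrite /pair_window lt_v.
split=> [le_Tt|lt_tT].
  have H j : j <= B -> pair_window X Y t (v + a * j) <= pair_window X Y t v.
    elim: j => [|j IHj] lt_j; first by rewrite muln0 addn0.
    have lt_N : a * j.+1 <= p by rewrite leq_mul.
    apply: leq_trans (IHj (ltnW lt_j)).
    have -> : v + a * j.+1 = v + a * j + a by lia.
    rewrite (leq_trans (hA t _ lt_t _)) //; first by lia.
    have -> : left_slack n0 (t * n0 + (v + a * j + a)) = false; last by rewrite addn0.
    have : T * n0 <= t * n0 by rewrite leq_mul.
    by rewrite /left_slack; lia.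
  exact: H.
have H j : j <= a -> pair_window X Y t v <= pair_window X Y t (v + j * B).
  elim: j => [|j IHj] lt_j; first by rewrite addn0.
  have lt_N : j.+1 * B <= p by rewrite leq_mul.
  apply: leq_trans (IHj (ltnW lt_j)) _.
  have -> : v + j.+1 * B = v + j * B + B by lia.
  rewrite (leq_trans (hB t _ lt_t _)) //; first by lia.
  have -> : bottom_slack n0 (t * n0 + (v + j * B)) = false; last by rewrite addn0.
  have : t.+1 * n0 <= T * n0 by rewrite leq_mul.
  by rewrite /bottom_slack /n0; lia.
exact: H.
Qed.

(** * Counting profiles by paths of blocks *)

Definition rank (X : state p) : nat :=
  \sum_(tv : 'I_K * 'I_p) (if tv.1 < T then r - X tv else X tv).

(** By [block_step_mono] every summand of the rank weakly decreases along a step, so equal ranks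
    force equal entries. *)
Lemma block_step_rank X Y : block_step X Y -> X = Y \/ rank Y < rank X.
Proof.
move=> XY.
have mono (tv : 'I_K * 'I_p) : (if tv.1 < T then r - Y tv else Y tv)
    <= (if tv.1 < T then r - X tv else X tv) ?= iff (X tv == Y tv).
  case: tv => t v /=; have := @block_step_mono X Y t v XY (ltn_ord t) (ltn_ord v).
  rewrite !entry_ord -val_eqE /=.
  have := ltn_ord (X (t, v)); have := ltn_ord (Y (t, v)).
  move=> lt_Y lt_X [HX HY]; case: (ltnP t T) => [/HY|/HX] {HX HY} le_XY; split; lia.
have := leqif_sum (fun tv (_ : true) => mono tv); rewrite -/(rank X) -/(rank Y).
case=> le_rk eq_rk; move: le_rk; rewrite leq_eqVlt eq_rk => /orP[/forallP XYE|]; last by right.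
by left; apply/ffunP => tv; apply/eqP; apply: XYE.
Qed.

Definition gluings (k : nat) : {set state p * k.-tuple (state p) * state l} :=
  [set d : state p * k.-tuple (state p) * state l |
     path block_step d.1.1 d.1.2 && gluing d.1.1 (last d.1.1 d.1.2) d.2].

(** Once the first block and the tail are fixed, the gluing condition only concerns the endpoint of
    the path. *)
Lemma gluings_eventually_poly : eventually_poly (fun k => #|gluings k|).
Proof.
pose F k := \sum_X \sum_Z paths _ block_step (fun Y => gluing X Y Z) k X.
have [N [q Fq]] : eventually_poly F.
  do 2!apply: eventually_poly_sum => ? _.
  exact: paths_eventually_poly block_step_rank.
exists N, q => k /Fq<-; congr _%:R%R.
rewrite -sum1dep_card big_mkcond /=.
rewrite -(pair_bigA _ (fun (Xs : state p * k.-tuple (state p)) Z =>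
  if path block_step Xs.1 Xs.2 && gluing Xs.1 (last Xs.1 Xs.2) Z then 1 else 0)) /=.
rewrite -(pair_bigA _ (fun X (s : k.-tuple _) =>
  \sum_Z if path block_step X s && gluing X (last X s) Z then 1 else 0)) /=.
apply: eq_bigr => X _; rewrite exchange_big /=; apply: eq_bigr => Z _.
by rewrite /paths -sum1dep_card [RHS]big_mkcond.
Qed.

(** Profiles are functions on an infinite type, so they are counted through a finite set that
    encodes them up to pointwise equality. *)
Lemma card_profiles (k : nat) (U : finType) (D : {set U}) (f : U -> nat -> nat) :
  (forall x, x \in D -> profile (p * k.+1 + l) (f x)) ->
  {in D &, forall x y, f x =1 f y -> x = y} ->
  (forall m, profile (p * k.+1 + l) m -> exists2 x, x \in D & f x =1 m) ->
  #|D| = #|gluings k|.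
Proof.
move=> fP f_inj f_surj.
pose decode_triple (d : state p * k.-tuple (state p) * state l) := decode k d.1.1 d.1.2 d.2.
have decode_tripleP d : reflect (profile (p * k.+1 + l) (decode_triple d)) (d \in gluings k).
  by rewrite inE; apply: profile_decode; rewrite size_tuple.
have decode_triple_inj d d' : decode_triple d =1 decode_triple d' -> d = d'.
  case: d d' => [[X s] Z] [[X' s'] Z'] /decode_inj[]; rewrite ?size_tuple //=.
  by move=> -> /val_inj-> ->.
have codeP x : exists d, x \in D -> decode_triple d =1 f x.
  case xD: (x \in D); last first.
    (* An arbitrary value outside D, needed to choose a code for every x at once. *)
    by exists ([ffun=> ord0], [tuple of nseq k [ffun=> ord0]], [ffun=> ord0]).
  by have [X [s [Z E]]] := decode_surj _ _ (fP _ xD); exists (X, s, Z).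
have [g gE] := fin_all_exists codeP.
rewrite -(@card_in_imset _ _ g D) => [|x y xD yD gxy]; last first.
  by apply: f_inj => // C; rewrite -gE // gxy gE.
apply: eq_card => d; apply/imsetP/idP => [[x xD ->]|/decode_tripleP/f_surj[x xD E]].
  by apply/decode_tripleP; apply: (eq_profile _ _ _ _ (fP _ xD)) => C; rewrite gE.
by exists x => //; apply: decode_triple_inj => C; rewrite gE // E.
Qed.

End Profiles.

(** * Young diagrams and profiles *)

Lemma card_le_values (U : finType) (D : {set U}) (f : U -> nat) (s : nat) :
  {in D &, injective f} -> (forall x, x \in D -> (f x < s)%N) -> (#|D| <= s)%N.
Proof.
move=> f_inj f_lt; rewrite cardE -(size_map f) -(size_iota 0 s).
apply: uniq_leq_size => [|y /mapP[x]].
  by rewrite map_inj_in_uniq ?enum_uniq // => x y; rewrite !mem_enum; apply: f_inj.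
by rewrite mem_enum => /f_lt lt_s ->; rewrite mem_iota.
Qed.

(** This will bound the sides of a diagram: the boxes of a row or column lie on distinct nonempty
    levels. *)
Lemma leq_sum_support (M k : nat) (m g : nat -> nat) :
  (forall x y, x < k -> y < k -> g x = g y -> x = y)%N ->
  (forall x, x < k -> g x < M /\ 0 < m (g x))%N ->
  (k <= \sum_(0 <= C < M) m C)%N.
Proof.
move=> g_inj gP; rewrite -(size_iota 0 k) -(size_map g).
have : (size [seq C <- index_iota 0 M | (0 < m C)%N] <= \sum_(0 <= C < M) m C)%N.
  rewrite size_filter -sum1_count big_mkcond /=; apply: leq_sum => C _.
  by case: (m C).
apply: leq_trans; apply: uniq_leq_size.
  rewrite map_inj_in_uniq ?iota_uniq // => x y.
  by rewrite !mem_iota !add0n /=; apply: g_inj.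
move=> y /mapP[x]; rewrite mem_iota add0n => /= /gP[lt_M m_gt0] ->.
by rewrite mem_filter m_gt0 mem_index_iota.
Qed.

Section Diagrams.
Local Open Scope nat_scope.
Variables a B r n : nat.
Hypotheses (a_gt0 : 0 < a) (B_gt0 : 0 < B) (aB : coprime a B).
Hypotheses (le_an : a <= n).
Let n_gt0 : 0 < n. Proof. exact: leq_trans le_an. Qed.
(** The extra 1 keeps the levels of boxes at least n, hence at least [a], as the last clause of
    [profile] requires. *)
Let T := B * r + 1.
Let K := T + a * r.

(* The levels of the boxes of the square [0, r n)^2 lie in [n, K n), so no
   subtraction is truncated there. *)
Definition lev (i j : nat) : nat := a * i + T * n - B * j.
(* The box (i, j) is reached from an end of its line by this number of
   steps (B, a). *)
Definition line_index (i j : nat) : nat := minn (i %/ B) (j %/ a).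

Lemma line_index_shift i j d : line_index (i + d * B) (j + d * a) = line_index i j + d.
Proof. by rewrite /line_index !divnDMl // addn_minl. Qed.

Lemma line_index_sub i j d : d <= line_index i j ->
  [/\ d * B <= i, d * a <= j & line_index (i - d * B) (j - d * a) = line_index i j - d].
Proof.
rewrite leq_min => /andP[]; rewrite !leq_divRL // => le_i le_j; split=> //.
by rewrite -{2}(subnK le_i) -{2}(subnK le_j) line_index_shift addnK.
Qed.

(** By coprimality two points of a line differ by d steps (B, a), and d steps raise the index by
    d. *)
Lemma lev_index_inj i j i' j' :
  a * i + B * j' = a * i' + B * j -> line_index i j = line_index i' j' -> i = i' /\ j = j'.
Proof.
wlog le_i : i j i' j' / i <= i' => [H|].
  case: (leqP i i') => [|/ltnW] le_i E sE; first exact: H.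
  by have [] := H i' j' i j le_i (esym E) (esym sE).
move=> E sE.
have E' : a * (i' - i) = B * (j' - j) by rewrite !mulnBr; lia.
have le_j : j <= j'.
  have : a * i <= a * i' by rewrite leq_mul.
  by move=> ?; have : B * j <= B * j' by [lia]; rewrite leq_pmul2l.
have /dvdnP[d dE] : B %| i' - i.
  by rewrite -(@Gauss_dvdr _ a) ?E' ?dvdn_mulr // coprime_sym.
have dE' : j' - j = d * a.
  by apply/eqP; rewrite -(eqn_pmul2l B_gt0) -E' dE; apply/eqP; lia.
move: sE; have -> : i' = i + d * B by lia.
have -> : j' = j + d * a by lia.
rewrite line_index_shift => ?; have -> : d = 0 by lia.
by rewrite !mul0n !addn0.
Qed.

Lemma point_exists C s : exists i j, C + B * j = a * i + T * n /\ line_index i j = s.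
Proof.
have [i0 [j0 E0]] : exists i0 j0, C + B * j0 = a * i0 + T * n.
  (* A multiple of [a] congruent to C - T n modulo B; the factor [B.-1] stands for -1. *)
  pose y := chinese a B 0 (C + T * n * B.-1).
  have /dvdnP[u yE] : a %| y by rewrite /dvdn chinese_modl // mod0n.
  have yB : y + T * n = C %[mod B].
    rewrite -modnDml chinese_modr // modnDml -addnA -mulnSr prednK //.
    by rewrite addnC modnMDl.
  (* Adding B C to u keeps the residue modulo B and makes the second coordinate nonnegative. *)
  have le_C : C <= a * (u + B * C) + T * n.
    have : 1 * C <= a * B * C by rewrite leq_mul // muln_gt0 a_gt0.
    by rewrite mulnDr mulnA; lia.
  have /dvdnP[v vE] : B %| a * (u + B * C) + T * n - C.
    have E : a * (u + B * C) + T * n = a * C * B + (y + T * n) by rewrite yE; lia.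
    by rewrite -eqn_mod_dvd // E modnMDl yB.
  by exists (u + B * C), v; lia.
(* Slide back to the point of index 0 on the line, then go s steps forward. *)
have [le_i le_j sE] := line_index_sub i0 j0 _ (leqnn (line_index i0 j0)).
exists (i0 - line_index i0 j0 * B + s * B), (j0 - line_index i0 j0 * a + s * a).
rewrite line_index_shift sE subnn; split=> //.
have : a * (i0 - line_index i0 j0 * B) + a * (line_index i0 j0 * B) = a * i0.
  by rewrite -mulnDr subnK.
have : B * (j0 - line_index i0 j0 * a) + B * (line_index i0 j0 * a) = B * j0.
  by rewrite -mulnDr subnK.
rewrite !mulnDr; lia.
Qed.

Local Notation N := (r * n).
Local Notation box := ('I_N * 'I_N)%type.

Lemma levK i j : j < N -> lev i j + B * j = a * i + T * n.
Proof.
move=> lt_j; rewrite subnK // /T mulnDl -mulnA.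
have : B * j <= B * N by rewrite leq_mul // ltnW.
lia.
Qed.

Lemma lev_bounds i j : i < N -> j < N -> n <= lev i j < K * n.
Proof.
move=> lt_i lt_j; have := levK i j lt_j; rewrite /K [in K * n]mulnDl.
have : B * j <= B * N by rewrite leq_mul // ltnW.
have : a * i.+1 <= a * N by rewrite leq_mul.
by rewrite mulnS /T !mulnDl -!mulnA; lia.
Qed.

(** * Diagrams cut into lines *)

Definition slice (L : {set box}) (C : nat) : {set box} :=
  [set x in L | lev x.1 x.2 == C].

Lemma slice_index_inj L C : {in slice L C &, injective (fun x : box => line_index x.1 x.2)}.
Proof.
move=> [i j] [i' j']; rewrite !inE /= => /andP[_ /eqP lx] /andP[_ /eqP ly] sE.
have := levK i j (ltn_ord j); have := levK i' j' (ltn_ord j') => ? ?.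
have [] := lev_index_inj i j i' j' _ sE; first by lia.
by move=> /ord_inj-> /ord_inj->.
Qed.

Definition ord_sub (i : 'I_N) (d : nat) : 'I_N :=
  Ordinal (leq_ltn_trans (leq_subr d i) (ltn_ord i)).

Lemma youngP (L : {set box}) :
  reflect (forall x y : box, x \in L -> y.1 <= x.1 -> y.2 <= x.2 -> y \in L)
          (young L).
Proof.
apply: (iffP 'forall_implyP) => H x.
  move=> y /H/forallP/(_ y)/implyP xy le1 le2; apply: xy.
  exact/andP.
by move=> xL; apply/forallP => y; apply/implyP => /andP[]; apply: H.
Qed.

Lemma slice_down L (x : box) d : young L -> x \in L -> d <= line_index x.1 x.2 ->
  let y := (ord_sub x.1 (d * B), ord_sub x.2 (d * a)) in
  [/\ y \in slice L (lev x.1 x.2) & line_index y.1 y.2 = line_index x.1 x.2 - d].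
Proof.
move=> /youngP yL xL /line_index_sub[le_i le_j sE] y; split=> //.
rewrite inE (yL x) ?leq_subr //=; apply/eqP.
have := levK x.1 x.2 (ltn_ord _).
have := levK y.1 y.2 (ltn_ord _); rewrite /= !mulnBr.
have : B * (d * a) <= B * x.2 by rewrite leq_mul.
have : a * (d * B) <= a * x.1 by rewrite leq_mul.
lia.
Qed.

(** If x is in L, so are all earlier points of its line. If it is not, no box of L on the line has
    an index at least that of x, and indices on a line are distinct. *)
Lemma in_young L (x : box) : young L ->
  (x \in L) = (line_index x.1 x.2 < #|slice L (lev x.1 x.2)|).
Proof.
move=> yL; apply/idP/idP => [xL|].
  pose g (d : 'I_(line_index x.1 x.2).+1) := (ord_sub x.1 (d * B), ord_sub x.2 (d * a)).
  have gP d : g d \in slice L (lev x.1 x.2) /\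
      line_index (g d).1 (g d).2 = line_index x.1 x.2 - d.
    by apply: slice_down => //; rewrite -ltnS.
  have g_inj : injective g.
    move=> d d' E; have [_] := gP d; have [_] := gP d'; rewrite E => -> E'.
    by apply: ord_inj; have := ltn_ord d; have := ltn_ord d'; lia.
  rewrite -[_.+1]card_ord -(card_imset _ g_inj) subset_leq_card //.
  by apply/subsetP => _ /imsetP[d _ ->]; have [] := gP d.
apply: contraTT => xL; rewrite -leqNgt.
apply: card_le_values (@slice_index_inj L _) _ => y yS.
rewrite ltnNge; apply: contra xL => le_s.
move: (yS); rewrite inE => /andP[yL' /eqP ly].
have [zS sz] := slice_down L y _ yL yL' (leq_subr (line_index x.1 x.2) _).
have xS : x \in slice setT (lev x.1 x.2) by rewrite !inE eqxx.
move: zS sz; set z := (_, _) => zS sz.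
have -> : x = z.
  apply: (@slice_index_inj setT (lev x.1 x.2)) => //.
    by move: zS; rewrite !inE ly => /andP[].
  by rewrite sz subKn.
by move: zS; rewrite inE => /andP[].
Qed.

Lemma slice_inj (L L' : {set box}) : young L -> young L' ->
  (forall C, #|slice L C| = #|slice L' C|) -> L = L'.
Proof. by move=> yL yL' E; apply/setP => x; rewrite !in_young // E. Qed.

Lemma card_residue (L : {set box}) c : c < n ->
  #|[set x in L | lev x.1 x.2 %% n == c]| = \sum_(t < K) #|slice L (t * n + c)|.
Proof.
move=> lt_c; rewrite -sum1dep_card.
under [RHS]eq_bigr => t _ do rewrite -sum1dep_card big_mkcondr.
rewrite big_mkcondr exchange_big /=; apply: eq_bigr => x _.
have /andP[_ lt_K] := lev_bounds x.1 x.2 (ltn_ord _) (ltn_ord _).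
have lt_t : lev x.1 x.2 %/ n < K by rewrite ltn_divLR.
have tE (t : 'I_K) : (lev x.1 x.2 == t * n + c) =
    (lev x.1 x.2 %% n == c) && (t == Ordinal lt_t).
  apply/eqP/andP => [E|[/eqP E /eqP->]]; last by rewrite /= -E -divn_eq.
  split; first by rewrite E modnMDl modn_small.
  by apply/eqP/ord_inj; rewrite /= E divnMDl // divn_small // addn0.
under eq_bigr => t _ do rewrite tE.
case: eqP => _; last by rewrite big1.
by rewrite (bigD1 (Ordinal lt_t)) //= eqxx big1 // => t /negPf->.
Qed.

Lemma color_lev (i j : nat) : j < N ->
  color a%:Z (- B%:Z)%R n i j = (lev i j %% n)%:Z.
Proof.
move=> lt_j; rewrite -modz_nat /color.
have -> : (lev i j)%:Z = (T%:Z * n%:Z + (a%:Z * i%:Z + - B%:Z * j%:Z))%R.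
  by have := levK i j lt_j; lia.
by rewrite modzMDl.
Qed.

Lemma balancedP (L : {set box}) :
  reflect (forall c, c < n -> \sum_(t < K) #|slice L (t * n + c)| = r)
          (balanced a%:Z (- B%:Z)%R n r L).
Proof.
have E c : c < n -> #|[set x in L | color a%:Z (- B%:Z)%R n x.1 x.2 == c%:Z]|
    = \sum_(t < K) #|slice L (t * n + c)|.
  move=> lt_c; rewrite -card_residue //; apply: eq_card => x.
  by rewrite !inE color_lev.
apply: (iffP 'forall_eqP) => [H c lt_c|H c]; last by rewrite E // H.
by rewrite -E //; apply: (H (Ordinal lt_c)).
Qed.

(** Moving boxes one step left, or one step down, injects the boxes of a line off the axis into the
    line of the neighbouring level; the slack pays for a box on the axis. *)
Lemma young_profile (L : {set box}) :
  L \in Bset a%:Z (- B%:Z)%R r n -> profile a B T K r n (fun C => #|slice L C|).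
Proof.
rewrite inE => /and3P[/youngP yL _ /balancedP sL].
have dn (i : 'I_N) : 0 < i -> ord_sub i 1 = i.-1 :> nat by rewrite /= subn1.
have sub_inj (i i' : 'I_N) : 0 < i -> 0 < i' -> ord_sub i 1 = ord_sub i' 1 -> i = i'.
  by move=> i_gt0 i'_gt0 /(congr1 val) /= E; apply: ord_inj; lia.
split=> // C.
- rewrite -(cardsID [set x : box | 0 < x.1] (slice L (C + a))).
  apply: leq_add.
    rewrite -(@card_in_imset _ _ (fun x : box => (ord_sub x.1 1, x.2))); last first.
      move=> [i j] [i' j']; rewrite !inE /= => /andP[_ i_gt0] /andP[_ i'_gt0] [E ->].
      by rewrite (sub_inj i i') //; apply: ord_inj.
    apply/subset_leq_card/subsetP => _ /imsetP[[i j] + ->].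
    rewrite !inE /= => /andP[/andP[xL /eqP lx] i_gt0].
    rewrite (yL (i, j)) ?leq_subr //=; apply/eqP.
    have := levK i j (ltn_ord j); have := levK (i - 1) j (ltn_ord j).
    rewrite mulnBr muln1; have : a * 1 <= a * i by rewrite leq_mul.
    by lia.
  (* A box with i = 0 has index 0, so the line holds at most one, and its presence forces the slack
     to be 1. *)
  apply: (card_le_values _ _ (fun x : box => line_index x.1 x.2)) => [x y|[i j]].
    by rewrite !in_setD => /andP[_ xS] /andP[_ yS]; apply: slice_index_inj xS yS.
  rewrite !inE /= -leqNgt leqn0 => /andP[/eqP i0 /andP[_ /eqP lx]].
  have lE := levK i j (ltn_ord j); rewrite lx i0 muln0 add0n in lE.
  have -> : left_slack B T n (C + a).
    by rewrite /left_slack -lE leq_addr (mulnC B) (addnC (C + a)) modnMDl eqxx.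
  by rewrite /line_index i0 div0n min0n.
- rewrite -(cardsID [set x : box | 0 < x.2] (slice L C)).
  apply: leq_add.
    rewrite -(@card_in_imset _ _ (fun x : box => (x.1, ord_sub x.2 1))); last first.
      move=> [i j] [i' j']; rewrite !inE /= => /andP[_ j_gt0] /andP[_ j'_gt0] [-> E].
      by rewrite (sub_inj j j') //; apply: ord_inj.
    apply/subset_leq_card/subsetP => _ /imsetP[[i j] + ->].
    rewrite !inE /= => /andP[/andP[xL /eqP lx] j_gt0].
    rewrite (yL (i, j)) ?leq_subr //=; apply/eqP.
    have := levK i j (ltn_ord j); have := levK i (ord_sub j 1) (ltn_ord _).
    rewrite /= mulnBr muln1; have : B * 1 <= B * j by rewrite leq_mul.
    by lia.
  apply: (card_le_values _ _ (fun x : box => line_index x.1 x.2)) => [x y|[i j]].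
    by rewrite !in_setD => /andP[_ xS] /andP[_ yS]; apply: slice_index_inj xS yS.
  rewrite !inE /= -leqNgt leqn0 => /andP[/eqP j0 /andP[_ /eqP lx]].
  have lE := levK i j (ltn_ord j); rewrite lx j0 muln0 addn0 in lE.
  have -> : bottom_slack a T n C.
    by rewrite /bottom_slack lE leq_addl (mulnC a) modnMDl eqxx.
  by rewrite /line_index j0 div0n minn0.
- move=> /orP C0; apply/eqP; rewrite cards_eq0; apply/eqP/setP => x.
  rewrite !inE; apply/negP => /andP[_ /eqP lx].
  by have := lev_bounds x.1 x.2 (ltn_ord _) (ltn_ord _); rewrite lx; lia.
Qed.

(** * The diagram of a profile *)

Section FromProfile.
Variable m : nat -> nat.
Hypothesis mP : profile a B T K r n m.

(** The diagram in the whole quadrant, before it is known to fit in the square; the first conjunct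
    rules out truncation in [lev]. *)
Definition below (i j : nat) : bool :=
  (B * j <= a * i + T * n) && (line_index i j < m (lev i j)).

(** Moving left never raises the index. When the slack is 1, B divides i + 1 and the index of (i +
    1, j) is (i + 1) / B, so it drops strictly and makes up for the slack. *)
Lemma below_left i j : below i.+1 j -> below i j.
Proof.
have [mA _ _ m0] := mP; rewrite /below /lev => /andP[].
move CE: (a * i.+1 + T * n - B * j) => C le_j lt_s.
have le_aC : a <= C by rewrite leqNgt; apply/negP => lt_C; rewrite m0 ?lt_C in lt_s.
rewrite mulnS in CE le_j; have le_j' : B * j <= a * i + T * n by lia.
rewrite le_j'; have := mA (a * i + T * n - B * j).
have -> : a * i + T * n - B * j + a = C by lia.
case e: (left_slack _ _ _ _) => /= le_m; last first.
  have : line_index i j <= line_index i.+1 j.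
    by rewrite leq_min geq_minr andbT (leq_trans (geq_minl _ _)) ?leq_div2r.
  by lia.
move: e => /andP[le_CT CT].
have /dvdnP[d dE] : B %| i.+1.
  rewrite -(@Gauss_dvdr _ a) 1?coprime_sym // -(@dvdn_addl (T * n - C)).
    by have -> : a * i.+1 + (T * n - C) = B * j by [rewrite mulnS; lia]; rewrite dvdn_mulr.
  by rewrite -eqn_mod_dvd // eq_sym.
have lt_d : line_index i j < d.
  by rewrite (leq_ltn_trans (geq_minl _ _)) // ltn_divLR // -dE.
have : line_index i.+1 j = d.
  rewrite /line_index dE mulnK //; apply/minn_idPl; rewrite leq_divRL // -(leq_pmul2l B_gt0).
  have : a * i.+1 = B * (d * a) by rewrite dE; lia.
  by rewrite mulnS; lia.
by lia.
Qed.

Lemma below_down i j : below i j.+1 -> below i j.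
Proof.
have [_ mB _ _] := mP; rewrite /below /lev => /andP[].
move CE: (a * i + T * n - B * j.+1) => C le_j lt_s.
rewrite mulnS in CE le_j; have le_j' : B * j <= a * i + T * n by lia.
rewrite le_j'; have := mB C.
have -> : C + B = a * i + T * n - B * j by lia.
case e: (bottom_slack _ _ _ _) => /= le_m; last first.
  have : line_index i j <= line_index i j.+1.
    by rewrite leq_min geq_minl (leq_trans (geq_minr _ _)) ?leq_div2r.
  by lia.
move: e => /andP[le_CT CT].
have /dvdnP[d dE] : a %| j.+1.
  rewrite -(@Gauss_dvdr _ B) // -(@dvdn_addl (C - T * n)).
    by have -> : B * j.+1 + (C - T * n) = a * i by [rewrite mulnS; lia]; rewrite dvdn_mulr.
  by rewrite -eqn_mod_dvd.
have lt_d : line_index i j < d.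
  by rewrite (leq_ltn_trans (geq_minr _ _)) // ltn_divLR // -dE.
have : line_index i j.+1 = d.
  rewrite /line_index dE mulnK //; apply/minn_idPr; rewrite leq_divRL // -(leq_pmul2l a_gt0).
  have : B * j.+1 = a * (d * B) by rewrite dE; lia.
  by rewrite mulnS; lia.
by lia.
Qed.

Lemma below_closed i j i' j' : i' <= i -> j' <= j -> below i j -> below i' j'.
Proof.
move=> /subnK<- /subnK<-; elim: (i - i') => [|d IHd]; last first.
  by rewrite addSn => /below_left.
by elim: (j - j') => [|d IHd] //; rewrite [d.+1 + j']addSn => /below_down.
Qed.

Lemma profile_sum : \sum_(0 <= C < K * n) m C = N.
Proof.
have [_ _ mS _] := mP; rewrite big_nat_mul.
under eq_bigr => t _ do rewrite -{1}(add0n (t * n)) big_addn mulSn addnK.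
rewrite exchange_big_nat /=.
transitivity (\sum_(0 <= c < n) r); last by rewrite sum_nat_const_nat subn0 mulnC.
apply: eq_big_nat => c /= /mS<-; rewrite big_mkord.
by apply: eq_bigr => t _; rewrite addnC.
Qed.

(** By closure the boxes (0, 0), ..., (i, 0) all belong to the diagram and lie on distinct levels,
    so i + 1 is at most the total r n; likewise for the column. *)
Lemma below_box i j : below i j -> i < N /\ j < N.
Proof.
have [_ _ _ m0] := mP.
have below_gt0 i' j' : below i' j' -> 0 < m (lev i' j') /\ lev i' j' < K * n.
  move=> /andP[_ lt_s]; split; first exact: leq_trans lt_s.
  by rewrite ltnNge; apply/negP => le_C; rewrite m0 ?le_C ?orbT in lt_s.
move=> bij; split; rewrite -profile_sum.
  apply: (leq_sum_support _ _ _ (fun i' => lev i' 0)) => [x y _ _|x lt_x].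
    by rewrite /lev muln0 !subn0 => /eqP; rewrite eqn_add2r eqn_pmul2l // => /eqP.
  have [] // := below_gt0 x 0 _; exact: below_closed bij.
have b0 x : x < j.+1 -> below 0 x by move=> lt_x; apply: below_closed bij.
apply: (leq_sum_support _ _ _ (lev 0)) => [x y /b0/andP[lex _] /b0/andP[ley _]|x lt_x].
  rewrite /lev => E; have : B * x == B * y by apply/eqP; lia.
  by rewrite eqn_pmul2l // => /eqP.
by have [] := below_gt0 _ _ (b0 _ lt_x).
Qed.

Definition diagram : {set box} := [set x : box | line_index x.1 x.2 < m (lev x.1 x.2)].

Lemma in_diagram (x : box) : (x \in diagram) = below x.1 x.2.
Proof.
rewrite inE /below; have := levK x.1 x.2 (ltn_ord _).
by move=> <-; rewrite leq_addl.
Qed.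

Lemma young_diagram : young diagram.
Proof.
by apply/youngP => x y; rewrite !in_diagram => bx le1 le2; apply: below_closed bx.
Qed.

Lemma slice_diagram C : #|slice diagram C| = m C.
Proof.
apply/eqP; rewrite eqn_leq; apply/andP; split.
  apply: card_le_values (@slice_index_inj diagram C) _ => x.
  by rewrite !inE => /andP[lt_s /eqP lx]; rewrite -lx.
case mC: (m C) => [//|s].
(* By [in_young], the single box of index m(C) - 1 on the line forces at least m(C) boxes. *)
have [i [j [E sE]]] := point_exists C s.
have lE : lev i j = C by rewrite /lev -E addnK.
have bij : below i j by rewrite /below -E leq_addl sE lE mC /=.
have [lt_i lt_j] := below_box i j bij.
pose x : box := (Ordinal lt_i, Ordinal lt_j).
have : x \in diagram by rewrite in_diagram.
by rewrite in_young ?young_diagram //= sE lE.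
Qed.

Lemma diagram_Bset : diagram \in Bset a%:Z (- B%:Z)%R r n.
Proof.
have [_ _ mS _] := mP.
rewrite inE young_diagram /=; apply/andP; split; last first.
  apply/balancedP => c lt_c; rewrite -[RHS](mS c lt_c).
  by apply: eq_bigr => t _; rewrite slice_diagram.
apply/eqP; have -> : diagram = [set x in diagram | true]
  by apply/setP => x; rewrite inE andbT.
rewrite -sum1dep_card.
rewrite (partition_big (fun x : box => Ordinal (ltn_pmod (lev x.1 x.2) n_gt0)) xpredT) //=.
transitivity (\sum_(c < n) r); last by rewrite sum_nat_const card_ord mulnC.
apply: eq_bigr => c _; rewrite -[RHS](mS c (ltn_ord c)).
under [RHS]eq_bigr => t _ do rewrite -slice_diagram.
rewrite -card_residue // -sum1dep_card; apply: eq_bigl => x.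
by rewrite andbT.
Qed.

End FromProfile.

End Diagrams.

(** * Quasipolynomiality *)

Lemma quasipoly_of_residues (p : nat) (f : nat -> nat) : (0 < p)%N ->
  (forall l, (l < p)%N -> eventually_poly (fun k => f (p * k.+1 + l)%N)) ->
  exists N : nat, exists P : nat -> {poly rat},
    forall n, (N <= n)%N -> (f n)%:R = (P (n %% p)%N).[n%:R].
Proof.
move=> p_gt0 fP.
have p_neq0 : p%:R != 0 :> rat by rewrite pnatr_eq0 -lt0n.
(* Induction on the number of residues treated, to collect one threshold and one family of
   polynomials. *)
suff /(_ p (leqnn p)) [N [P PE]] : forall M, (M <= p)%N -> exists N : nat,
    exists P : nat -> {poly rat}, forall n, (N <= n)%N -> (n %% p < M)%N ->
      (f n)%:R = (P (n %% p)%N).[n%:R].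
  by exists N, P => n le_n; rewrite PE ?ltn_mod.
elim=> [|l IHl] lt_l; first by exists 0%N, (fun=> 0).
have [N [P PE]] := IHl (ltnW lt_l); have [N' [q qE]] := fP l lt_l.
(* The substitution k = (n - l) / p - 1 inverts n = p (k + 1) + l. *)
pose Q := q \Po ((p%:R^-1)%:P * ('X - l%:R%:P) - 1%:P).
exists (N + p * N'.+1 + l)%N, (fun i => if i == l then Q else P i) => n le_n.
rewrite ltnS leq_eqVlt; case: eqP => [nl _|_ /= lt_nl]; last by apply: PE; lia.
have le_Nk : (N' < n %/ p)%N by rewrite leq_divRL // mulnC; lia.
have nE : n = (p * (n %/ p).-1.+1 + l)%N.
  by rewrite prednK ?(leq_trans _ le_Nk) // mulnC -nl -divn_eq.
rewrite [in LHS]nE qE; last by lia.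
rewrite /Q horner_comp !hornerE; congr (q.[_]).
by rewrite [in RHS]nE natrD natrM -natr1; field.
Qed.

(** Transposition of diagrams exchanges the roles of a and b; being injective, it gives both
    inequalities. *)
Lemma Bcard_swap (a b : int) (r n : nat) : Bcard a b r n = Bcard b a r n.
Proof.
suff le a' b' : (Bcard a' b' r n <= Bcard b' a' r n)%N by apply/eqP; rewrite eqn_leq !le.
pose sw (x : 'I_(r * n) * 'I_(r * n)) := (x.2, x.1).
have swK : involutive sw by case.
have sw_inj := inv_inj swK.
have mem_sw (L : {set _}) x : (x \in sw @: L) = (sw x \in L).
  by rewrite -{1}(swK x) mem_imset.
rewrite /Bcard -(card_imset _ (imset_inj sw_inj)) subset_leq_card //.
apply/subsetP => _ /imsetP[L + ->]; rewrite !inE => /and3P[yL cL bL].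
rewrite card_imset // cL; apply/andP; split.
  apply/youngP => x y; rewrite !mem_sw => xL le1 le2.
  by move/youngP: yL; apply; first exact: xL.
apply/forallP => c; apply/eqP; rewrite -[RHS](eqP (forallP bL c)) -[RHS](card_imset _ sw_inj).
apply: eq_card => x; rewrite !inE !mem_sw !inE /color /=.
by rewrite addrC.
Qed.

Lemma Bcard_quasipoly (a B r : nat) : (0 < a)%N -> (0 < B)%N -> coprime a B ->
  exists N : nat, exists P : nat -> {poly rat},
    forall n, (N <= n)%N ->
      (Bcard a%:Z (- B%:Z) r n)%:R = (P (n %% (a * B))%N).[n%:R].
Proof.
move=> a_gt0 B_gt0 aB; apply: quasipoly_of_residues => [|l lt_l].
  by rewrite muln_gt0 a_gt0.
have [N [q qE]] :=
  gluings_eventually_poly a B (B * r + 1) (B * r + 1 + a * r) r a_gt0 B_gt0 l lt_l.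
exists N, q => k /qE<-; congr _%:R.
have le_an : (a <= a * B * k.+1 + l)%N.
  by apply: leq_trans (leq_addr _ _); rewrite -mulnA leq_pmulr // muln_gt0 B_gt0.
(* A balanced diagram is encoded by the sizes of its slices. *)
apply: (card_profiles a B _ _ r a_gt0 B_gt0 l lt_l k _ _
         (fun L C => #|slice a B r (a * B * k.+1 + l) L C|)).
- by move=> L LB; apply: young_profile.
- move=> L L'; rewrite !inE => /andP[yL _] /andP[yL' _].
  exact: slice_inj.
move=> m mP; exists (diagram a B r _ m); first exact: diagram_Bset.
by move=> C; apply: slice_diagram.
Qed.

Theorem theorem1p3 (r : nat) (a b : int) :
  (0 < r)%N -> gcdz a b = 1%N -> a * b < 0 ->
  exists N : nat, exists p : nat -> {poly rat},
    forall n : nat, (N <= n)%N ->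
      (Bcard a b r n)%:R = (p (n %% absz (a * b)%R)%N).[n%:R].
Proof.
move=> _ ab1 ab_lt0.
(* If [a] is not positive then [b] is, and transposing reduces to the other case. *)
wlog a_gt0 : a b ab1 ab_lt0 / 0 < a => [H|].
  have [|a_le0] := ltP 0 a; first exact: H.
  have ba1 : gcdz b a = 1%N by rewrite gcdzC.
  have ba_lt0 : b * a < 0 by rewrite mulrC.
  have b_gt0 : 0 < b by nia.
  have [N [p pE]] := H b a ba1 ba_lt0 b_gt0.
  by exists N, p => n /pE; rewrite Bcard_swap [b * a]mulrC.
have b_lt0 : b < 0 by rewrite pmulr_rlt0 in ab_lt0.
have aE : a = (absz a)%:Z by rewrite gtz0_abs.
have bE : b = - (absz b)%:Z by rewrite ltz0_abs ?opprK.
rewrite abszM aE bE abszN /=.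
apply: Bcard_quasipoly; [lia|lia|].
by apply/eqP; move: ab1; rewrite /gcdz => -[].
Qed.
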